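(* Let $W$ be a nondeterministic recursive probabilistic program (given by its control-flow graph) with a sampling function $\Upsilon$. For every conditionally difference-bounded ranking measure function $h$ for $W$ with corresponding constants $\delta,\zeta\in(0,\infty)$, $$\overline T(\mathfrak c)\ge\frac{h(\mathfrak c)}{\delta}$$ for all stack elements $\mathfrak c$ such that $h(\mathfrak c)<\infty$.
   Context: **Programs.** For a finite set $V$ of variables, $\mathrm{Val}_V$ is the set of functions (valuations) $V\to\mathbb Z$. A nondeterministic recursive probabilistic program $W$ is represented by its control-flow graph: a finite set $F$ of function names, a finite set $V_r$ of sampling variables and, for each $f\in F$: a finite set $V^f$ of program variables (write $\mathrm{Val}_f:=\mathrm{Val}_{V^f}$); a finite set $L^f$ of labels partitioned into branching labels $L_b^f$, assignment labels $L_a^f$, call labels $L_c^f$ and nondeterministic labels $L_d^f$; an initial label $\ell_{in}^f\in L^f$ and a terminal label $\ell_{out}^f\in L^f$ with $\ell_{in}^f\ne\ell_{out}^f$; and a set $\to_f$ of triples (source label, decoration, target label). For each $\ell\in L^f\setminus\{\ell_{out}^f\}$ the triples with source $\ell$ are: - if $\ell\in L_a^f$: exactly one triple $(\ell,u,\ell')$ with update function $u:\mathrm{Val}_f\times\mathrm{Val}_{V_r}\to\mathrm{Val}_f$; - if $\ell\in L_c^f$: exactly one triple $(\ell,(g,v),\ell')$ with $g\in F$ and value-passing function $v:\mathrm{Val}_f\to\mathrm{Val}_g$; - if $\ell\in L_b^f$: exactly two triples $(\ell,\phi,\ell_1),(\ell,\neg\phi,\ell_2)$ with $\phi$ a propositional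 arithmetic predicate over $V^f$ (Boolean combination of comparisons of integer-valued arithmetic expressions); - if $\ell\in L_d^f$: exactly two triples $(\ell,\star,\ell_1),(\ell,\star,\ell_2)$ (the then-branch and the else-branch, respectively). **Sampling.** A sampling function $\Upsilon$ assigns to each $r\in V_r$ a discrete probability distribution on $\mathbb Z$; $\overline\Upsilon(\mu):=\prod_{r\in V_r}\Upsilon(r)(\mu(r))$ for $\mu\in\mathrm{Val}_{V_r}$, and $\mathrm{Val}^r:=\{\mu:\overline\Upsilon(\mu)>0\}$. **Semantics.** A stack element is a triple $(f,\ell,\nu)$ with $f\in F$, $\ell\in L^f$, $\nu\in\mathrm{Val}_f$; it is terminal if $\ell=\ell_{out}^f$. $\mathcal E$ is the set of stack elements. A configuration is a finite word (possibly the empty word $\varepsilon$) of non-terminal stack elements, the first letter being the top of the stack. For a stack element $\mathfrak d$ let $[\mathfrak d]$ be the one-letter word $\mathfrak d$ if $\mathfrak d$ is non-terminal and $\varepsilon$ otherwise. States are pairs $(w,\mu)$ of a configuration and $\mu\in\mathrm{Val}_{V_r}$. In one step from $((f,\ell,\nu)\cdot w,\mu)$, $\mu'$ is drawn with probability $\overline\Upsilon(\mu')$ and the next state is $(w',\mu')$ where - assignment: $w'=[(f,\ell',u(\nu,\mu'))]\cdot w$; - call: $w'=(g,\ell_{in}^g,v(\nu))\cdot[(f,\ell',\nu)]\cdot w$; - branching: $w'=[(f,\ell_1,\nu)]\cdot w$ if $\nu\models\phi$, and $w'=[(f,\ell_2,\nu)]\cdot w$ otherwise; - nondeterministic: $w'=[(f,\ell_1,\nu)]\cdot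 w$ under action $\mathbf{th}$ and $w'=[(f,\ell_2,\nu)]\cdot w$ under action $\mathbf{el}$. From $(\varepsilon,\mu)$ the next state is $(\varepsilon,\mu')$ with probability $\overline\Upsilon(\mu')$. In non-nondeterministic states there is effectively a single action $\tau$; when the top label is nondeterministic the enabled actions are $\mathbf{th},\mathbf{el}$. A history is a finite nonempty sequence of states in which each consecutive pair has positive transition probability under some action. A scheduler $\sigma$ maps every history to a probability distribution over the actions enabled at its last state. For a scheduler $\sigma$ and a non-terminal stack element $\mathfrak c$, $\mathbb P^\sigma_{\mathfrak c}$ (expectation $\mathbb E^\sigma_{\mathfrak c}$) is the induced probability measure on infinite sequences of states starting in $(\mathfrak c,\mathbf 0)$, where $\mathbf 0$ is the zero valuation. **Termination time.** $T(\{(w_n,\mu_n)\}_{n\ge0}):=\min\{n\ge 0: w_n=\varepsilon\}$ ($\min\emptyset=\infty$). $\overline T:\mathcal E\to[0,\infty]$ is $\overline T(\mathfrak c):=\sup_\sigma\mathbb E^\sigma_{\mathfrak c}(T)$ if $\mathfrak c$ is non-terminal (sup over all schedulers), and $\overline T(\mathfrak c):=0$ if terminal. **Ranking measure functions.** A ranking measure function for $W$ is a function $h:\mathcal E\to[0,\infty]$ for which there is $\epsilon\in(0,\infty)$ such that for all stack elements $(f,\ell,\nu)$: - (C1) if $\ell=\ell_{out}^f$ then $h(f,\ell,\nu)=0$; - (C2) if $\ell\in L_a^f\setminus\{\ell_{out}^f\}$ and $(\ell,u,\ell')$ is the only triple in $\to_f$ with source $\ell$: $\epsilon+\sum_{\mu\in\mathrm{Val}^r}\overline\Upsilon(\mu)\,h(f,\ell',u(\nu,\mu))\le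 h(f,\ell,\nu)$; - (C3) if $\ell\in L_c^f\setminus\{\ell_{out}^f\}$ and $(\ell,(g,v),\ell')$ is the only triple in $\to_f$ with source $\ell$: $\epsilon+h(g,\ell_{in}^g,v(\nu))+h(f,\ell',\nu)\le h(f,\ell,\nu)$; - (C4) if $\ell\in L_b^f\setminus\{\ell_{out}^f\}$ and $(\ell,\phi,\ell_1),(\ell,\neg\phi,\ell_2)$ are the two triples in $\to_f$ with source $\ell$: $\mathbf 1_{\nu\models\phi}h(f,\ell_1,\nu)+\mathbf 1_{\nu\models\neg\phi}h(f,\ell_2,\nu)+\epsilon\le h(f,\ell,\nu)$; - (C5) if $\ell\in L_d^f\setminus\{\ell_{out}^f\}$ and $(\ell,\star,\ell_1),(\ell,\star,\ell_2)$ are the two triples in $\to_f$ with source $\ell$: $\max\{h(f,\ell_1,\nu),h(f,\ell_2,\nu)\}+\epsilon\le h(f,\ell,\nu)$. Conventions: $d\cdot\infty=\infty$ for $d\in(0,\infty]$, $0\cdot\infty=0$. **Conditional difference-boundedness.** A ranking measure function $h$ is conditionally difference-bounded with constants $\delta,\zeta\in(0,\infty)$ if for all stack elements $(f,\ell,\nu)$ with $h(f,\ell,\nu)<\infty$: - (C6) if $\ell\in L_a^f\setminus\{\ell_{out}^f\}$ and $(\ell,u,\ell')$ is the only triple in $\to_f$ with source $\ell$: $\delta+\sum_{\mu\in\mathrm{Val}^r}\overline\Upsilon(\mu)h(f,\ell',u(\nu,\mu))\ge h(f,\ell,\nu)$ and $\sum_{\mu\in\mathrm{Val}^r}\overline\Upsilon(\mu)\,|h(f,\ell',u(\nu,\mu))-h(f,\ell,\nu)|\le\zeta$;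 - (C7) if $\ell\in L_c^f\setminus\{\ell_{out}^f\}$ and $(\ell,(g,v),\ell')$ is the only triple in $\to_f$ with source $\ell$: $\delta+h(g,\ell_{in}^g,v(\nu))+h(f,\ell',\nu)\ge h(f,\ell,\nu)$; - (C8) if $\ell\in L_b^f\setminus\{\ell_{out}^f\}$ and $(\ell,\phi,\ell_1),(\ell,\neg\phi,\ell_2)$ are the two triples in $\to_f$ with source $\ell$: $\mathbf 1_{\nu\models\phi}h(f,\ell_1,\nu)+\mathbf 1_{\nu\models\neg\phi}h(f,\ell_2,\nu)+\delta\ge h(f,\ell,\nu)$; - (C9) if $\ell\in L_d^f\setminus\{\ell_{out}^f\}$ and $(\ell,\star,\ell_1),(\ell,\star,\ell_2)$ are the two triples in $\to_f$ with source $\ell$: $\max\{h(f,\ell_1,\nu),h(f,\ell_2,\nu)\}+\delta\ge h(f,\ell,\nu)$. *)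

(* Defs.v *)
(* MathComp + MathComp-Analysis. *)
From HB Require Import structures.
From mathcomp Require Import all_boot all_order all_algebra.
From mathcomp Require Import all_classical all_reals all_analysis.
Set Implicit Arguments.
Unset Strict Implicit.
Unset Printing Implicit Defensive.
Import Order.TTheory GRing.Theory Num.Theory.
Local Open Scope classical_set_scope.
Local Open Scope ring_scope.
Local Open Scope ereal_scope.

Notation valuation V := {ffun V -> int}.

(* Integer-valued arithmetic expressions are represented by the functions they
   denote, so no choice of arithmetic operators is imposed. *)
Inductive comparison := CmpEq | CmpLe | CmpLt.

Inductive predicate (V : finType) :=
| PCmp of comparison & (valuation V -> int) & (valuation V -> int)
| PNot of predicate V
| PAnd of predicate V & predicate V
| POr of predicate V & predicate V.

Definition compare (c : comparison) (x y : int) : bool :=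
  match c with CmpEq => x == y | CmpLe => (x <= y)%R | CmpLt => (x < y)%R end.

Fixpoint sat (V : finType) (nu : valuation V) (phi : predicate V) : bool :=
  match phi with
  | PCmp c e1 e2 => compare c (e1 nu) (e2 nu)
  | PNot p => ~~ sat nu p
  | PAnd p q => sat nu p && sat nu q
  | POr p q => sat nu p || sat nu q
  end.

(* The triples of the transition relation with a given source label: their
   decorations and their targets.  [Branch phi l1 l2] stands for the two triples
   decorated by phi and its negation; in [Nondet l1 l2] the first target is the
   then-branch. *)
Inductive instruction (F Vr : finType) (V L : F -> finType) (f : F) :=
| Assign (u : valuation (V f) -> valuation Vr -> valuation (V f)) (l' : L f)
| Call (g : F) (v : valuation (V f) -> valuation (V g)) (l' : L f)
| Branch (phi : predicate (V f)) (l1 l2 : L f)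
| Nondet (l1 l2 : L f).
Arguments Assign {F Vr V L f} u l'.
Arguments Call {F Vr V L f} g v l'.
Arguments Branch {F Vr V L f} phi l1 l2.
Arguments Nondet {F Vr V L f} l1 l2.

(* The constructor of [instr l] tells to which of the four classes the label l
   belongs.  The payload of [instr] at the terminal label is never used. *)
Record program := Program {
  funs : finType;
  svar : finType;
  pvar : funs -> finType;
  label : funs -> finType;
  linit : forall f, label f;
  lout : forall f, label f;
  linit_neq_lout : forall f, linit f != lout f;
  instr : forall f, label f -> instruction svar pvar label f }.

Record sampling (R : realType) (W : program) := Sampling {
  mass : svar W -> int -> R;
  mass_ge0 : forall r z, (0 <= mass r z)%R;
  mass_sum1 : forall r, \esum_(z in [set: int]) (mass r z)%:E = 1 }.

Definition joint (R : realType) (W : program) (U : sampling R W)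
  (mu : valuation (svar W)) : R := (\prod_r mass U r (mu r))%R.

Definition Valr (R : realType) (W : program) (U : sampling R W) :
  set (valuation (svar W)) := [set mu | (0 < joint U mu)%R].

Definition selem (W : program) :=
  {f : funs W & (label f * valuation (pvar f))%type}.
HB.instance Definition _ W := Countable.on (selem W).

Definition se (W : program) (f : funs W) (l : label f)
    (nu : valuation (pvar f)) : selem W :=
  existT (fun f => (label f * valuation (pvar f))%type) f (l, nu).

Definition terminal (W : program) (d : selem W) : bool :=
  (tagged d).1 == lout (tag d).

Definition nselem (W : program) := {d : selem W | ~~ terminal d}.
HB.instance Definition _ W := Countable.on (nselem W).
HB.instance Definition _ W := SubType.on (nselem W).

Definition se_init (W : program) (g : funs W) (nu : valuation (pvar g)) :
  nselem W := exist _ (se (linit g) nu) (linit_neq_lout g).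

Definition config (W : program) := seq (nselem W).
HB.instance Definition _ W := Countable.on (config W).

Definition word (W : program) (d : selem W) : config W :=
  if insub d is Some d' then [:: d'] else [::].

Definition state (W : program) := (config W * valuation (svar W))%type.
HB.instance Definition _ W := Countable.on (state W).
Definition state0 (W : program) : state W := ([::], [ffun=> 0%R]).
HB.instance Definition _ W := isPointed.Build (state W) (state0 W).

Inductive action := th | el | tau.

Definition action_code (a : action) : option bool :=
  match a with th => Some true | el => Some false | tau => None end.
Definition action_decode (b : option bool) : action :=
  match b with Some true => th | Some false => el | None => tau end.
Lemma action_codeK : cancel action_code action_decode.
Proof. by case. Qed.
HB.instance Definition _ := Finite.copy action (can_type action_codeK).

Definition nondet_top (W : program) (w : config W) : bool :=
  if w is d :: _ then
    if instr (tagged (val d)).1 is Nondet _ _ then true else false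
  else false.

Definition enabled (W : program) (s : state W) (a : action) : bool :=
  if nondet_top s.1 then a != tau else a == tau.

(* The action matters only at nondeterministic labels; the value there under
   [tau] is junk, as [tau] is not enabled. *)
Definition next_config (W : program) (w : config W) (a : action)
    (mu' : valuation (svar W)) : config W :=
  match w with
  | [::] => [::]
  | d :: w0 =>
    let: existT f (l, nu) := val d in
    match instr l with
    | Assign u l' => word (se l' (u nu mu')) ++ w0
    | Call g v l' => se_init (v nu) :: word (se l' nu) ++ w0
    | Branch phi l1 l2 => word (se (if sat nu phi then l1 else l2) nu) ++ w0
    | Nondet l1 l2 => word (se (if a is th then l1 else l2) nu) ++ w0
    end
  end.

Definition trans (R : realType) (W : program) (U : sampling R W)
    (a : action) (s s' : state W) : R :=
  if enabled s a && (s'.1 == next_config s.1 a s'.2) then joint U s'.2 else 0%R.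

Definition history (R : realType) (W : program) (U : sampling R W)
    (H : seq (state W)) : bool :=
  (H != [::]) &&
  sorted (fun s s' => [exists a : action, (0 < trans U a s s')%R]) H.

(* Values of [sched] outside of histories are irrelevant. *)
Record scheduler (R : realType) (W : program) (U : sampling R W) := Scheduler {
  sched : seq (state W) -> action -> R;
  sched_ge0 : forall H a, history U H -> (0 <= sched H a)%R;
  sched_sum1 : forall H, history U H -> (\sum_a sched H a)%R = 1%R;
  sched_enabled : forall H a, history U H -> ~~ enabled (last (state0 W) H) a ->
    sched H a = 0%R }.

Definition cylinder (W : program) (H : seq (state W)) : set (nat -> state W) :=
  [set rho | mkseq rho (size H) = H].

Notation runs W := (g_sigma_algebraType (range (@cylinder W))).

Definition cylinder_prob (R : realType) (W : program) (U : sampling R W)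
    (sigma : scheduler U) (c : nselem W) (H : seq (state W)) : R :=
  ((nth (state0 W) H 0 == ([:: c], [ffun=> 0%R]))%:R *
   \prod_(i < (size H).-1)
     \sum_a sched sigma (take i.+1 H) a *
            trans U a (nth (state0 W) H i) (nth (state0 W) H i.+1))%R.

(* For given sigma and c exactly one P satisfies this (Ionescu-Tulcea). *)
Definition path_measure (R : realType) (W : program) (U : sampling R W)
    (sigma : scheduler U) (c : nselem W) (P : probability (runs W) R) : Prop :=
  forall H : seq (state W), H != [::] ->
    P (cylinder H) = (cylinder_prob sigma c H)%:E.

Definition termination_time (R : realType) (W : program) (rho : runs W) :
  \bar R := ereal_inf [set n%:R%:E | n in [set n : nat | (rho n).1 = [::]]].

Definition Tbar (R : realType) (W : program) (U : sampling R W)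
    (c : selem W) : \bar R :=
  if insub c is Some c' then
    ereal_sup [set x | exists (sigma : scheduler U) (P : probability (runs W) R),
      path_measure sigma c' P /\ x = \int[P]_rho termination_time R rho]
  else 0.

Definition ranking_measure (R : realType) (W : program) (U : sampling R W)
    (h : selem W -> \bar R) : Prop :=
  (forall d, 0 <= h d) /\
  exists2 eps : R, (0 < eps)%R &
  [/\ forall (f : funs W) nu, h (se (lout f) nu) = 0,
      forall (f : funs W) (l : label f) nu u l', l != lout f ->
        instr l = Assign u l' ->
        eps%:E + \esum_(mu in Valr U) ((joint U mu)%:E * h (se l' (u nu mu)))
          <= h (se l nu),
      forall (f : funs W) (l : label f) nu g v l', l != lout f ->
        instr l = Call g v l' ->
        eps%:E + h (se (linit g) (v nu)) + h (se l' nu) <= h (se l nu),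
      forall (f : funs W) (l : label f) nu phi l1 l2, l != lout f ->
        instr l = Branch phi l1 l2 ->
        (sat nu phi)%:R%:E * h (se l1 nu) +
        (sat nu (PNot phi))%:R%:E * h (se l2 nu) + eps%:E <= h (se l nu) &
      forall (f : funs W) (l : label f) nu l1 l2, l != lout f ->
        instr l = Nondet l1 l2 ->
        maxe (h (se l1 nu)) (h (se l2 nu)) + eps%:E <= h (se l nu)].

Definition cond_difference_bounded (R : realType) (W : program)
    (U : sampling R W) (h : selem W -> \bar R) (delta zeta : R) : Prop :=
  [/\ forall (f : funs W) (l : label f) nu u l', h (se l nu) < +oo ->
        l != lout f -> instr l = Assign u l' ->
        h (se l nu) <= delta%:E +
          \esum_(mu in Valr U) ((joint U mu)%:E * h (se l' (u nu mu))) /\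
        \esum_(mu in Valr U)
          ((joint U mu)%:E * `|h (se l' (u nu mu)) - h (se l nu)|) <= zeta%:E,
      forall (f : funs W) (l : label f) nu g v l', h (se l nu) < +oo ->
        l != lout f -> instr l = Call g v l' ->
        h (se l nu) <= delta%:E + h (se (linit g) (v nu)) + h (se l' nu),
      forall (f : funs W) (l : label f) nu phi l1 l2, h (se l nu) < +oo ->
        l != lout f -> instr l = Branch phi l1 l2 ->
        h (se l nu) <= (sat nu phi)%:R%:E * h (se l1 nu) +
          (sat nu (PNot phi))%:R%:E * h (se l2 nu) + delta%:E &
      forall (f : funs W) (l : label f) nu l1 l2, h (se l nu) < +oo ->
        l != lout f -> instr l = Nondet l1 l2 ->
        h (se l nu) <= maxe (h (se l1 nu)) (h (se l2 nu)) + delta%:E].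

(* Main.v *)
Require Import Defs.
From HB Require Import structures.
From mathcomp Require Import all_boot all_order all_algebra lra.
From mathcomp Require Import all_classical all_reals all_analysis.
From mathcomp Require Import measurable_realfun.
Set Implicit Arguments.
Unset Strict Implicit.
Unset Printing Implicit Defensive.
Import Order.TTheory GRing.Theory Num.Theory.
Local Open Scope classical_set_scope.
Local Open Scope ring_scope.

(* Let H(w) be the sum of h over the stack w, and let the memoryless scheduler
   at a nondeterministic label pick a branch maximizing h.  Under it, while the
   stack is nonempty and H is finite, one step decreases H in expectation by at
   least eps and at most delta, and E|H(w') - H(w)| is bounded by a constant z.
   With K the one-step expectation operator and V(w) = sum_k K^k 1_{w <> empty}
   the expected termination time, eps V <= H, so V is finite.  As H vanishes on
   termination, the increments bound gives H <= z V; hence K^n H <= z K^n V,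
   the tail of a convergent series, tends to 0.  Iterating H <= delta + K H
   then yields H <= delta V.
   The law of the runs is the image of Lebesgue measure on [0, 1[ under the map
   sending x to the run whose finite prefixes are the histories r with x in
   I(r), where the I(r) are nested half-open intervals of length the
   probability of r. *)

Local Open Scope ereal_scope.

(** * Sums over countable types *)

Lemma esumZl (R : realType) (T : choiceType) (I : set T) (x : R)
    (a : T -> \bar R) : (0 <= x)%R -> (forall i, 0 <= a i) ->
  \esum_(i in I) (x%:E * a i) = x%:E * \esum_(i in I) a i.
Proof.
move=> x0 a0; rewrite /esum -ereal_supZl//; last first.
  apply/set0P; exists 0 => /=.
  by exists set0; [exact: fsets_set0|rewrite fsbig_set0].
congr ereal_sup; rewrite image_comp; apply: eq_imagel => X _ /=.
by rewrite ge0_mule_fsumr.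
Qed.

(** Induction on an enumeration of [V]: a function equal to [t0] off [r :: s] amounts to its value
    at [r] and a function equal to [t0] off [s], so one factor of total mass 1 splits off at each
    step. *)
Lemma esum_prod_ffun (R : realType) (V : finType) (T : choiceType) (t0 : T)
    (m : V -> T -> R) :
  (forall r z, (0 <= m r z)%R) -> (forall r, \esum_(z in setT) (m r z)%:E = 1) ->
  \esum_(mu in [set: {ffun V -> T}]) (\prod_r m r (mu r))%R%:E = 1.
Proof.
move=> m0 m1.
pose D (s : seq V) := [set mu : {ffun V -> T} | forall r, r \notin s -> mu r = t0].
have -> : [set: {ffun V -> T}] = D (enum V).
  by apply/seteqP; split => mu // _ r; rewrite mem_enum.
under eq_esum do rewrite -big_enum/=.
elim: (enum V) (enum_uniq V) => [|r s IH] /=.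
  move=> _; have -> : D [::] = [set [ffun=> t0]].
    apply/seteqP; split => mu /=; last by move=> -> r _; rewrite ffunE.
    by move=> h; apply/ffunP => r; rewrite ffunE h.
  by rewrite esum_set1 big_nil.
move=> /andP[rs us].
pose e (k : T * {ffun V -> T}) : {ffun V -> T} :=
  [ffun x => if x == r then k.1 else k.2 x].
rewrite (@reindex_esum R _ _ ([set: T] `*`` (fun=> D s)) _ e); last first.
  split.
  - move=> [z mu] [_ /= h] x; rewrite inE negb_or ffunE => /andP[/negbTE -> /=].
    exact: h.
  - move=> [z mu] [z' mu'] /set_mem[/= _ h] /set_mem[/= _ h'] /ffunP E.
    have := E r; rewrite !ffunE eqxx /= => ->; congr pair; apply/ffunP => x.
    have := E x; rewrite !ffunE; case: eqP => [->|//].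
    by rewrite h // h'.
  - move=> mu h; exists (mu r, [ffun x => if x == r then t0 else mu x]) => /=.
      split => // x xs; rewrite ffunE; case: eqP => // /eqP xr.
      by apply: h; rewrite inE negb_or xr.
    by apply/ffunP => x; rewrite !ffunE; case: eqP => [->|].
transitivity (\esum_(z in [set: T]) \esum_(mu in D s)
    ((m r z)%:E * (\prod_(i <- s) m i (mu i))%:E)).
  rewrite esum_esum; last first.
    by move=> z mu _ _; rewrite mule_ge0 ?lee_fin ?prodr_ge0.
  apply: eq_esum => -[z mu] _; rewrite big_cons ffunE eqxx EFinM; congr (_ * _%:E).
  apply: eq_big_seq => i si; rewrite ffunE; case: eqP => // ir.
  by rewrite -ir si in rs.
rewrite -{1}(m1 r); apply: eq_esum => z _.
rewrite esumZl // ?IH ?mule1// => mu.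
by rewrite lee_fin prodr_ge0.
Qed.

Lemma esum_joint (R : realType) (W : program) (U : sampling R W) :
  \esum_(mu in [set: valuation (svar W)]) (joint U mu)%:E = 1.
Proof. apply: (esum_prod_ffun (0%R : int)); [exact: mass_ge0|exact: mass_sum1]. Qed.

Lemma joint_ge0 (R : realType) (W : program) (U : sampling R W) mu :
  (0 <= joint U mu)%R.
Proof. by apply: prodr_ge0 => r _; exact: mass_ge0. Qed.

(** * The one-step expectation operator *)

Lemma exchange_esum (R : realType) (I J : choiceType) (a : I -> J -> \bar R) :
  (forall i j, 0 <= a i j) ->
  \esum_(i in setT) \esum_(j in setT) a i j =
  \esum_(j in setT) \esum_(i in setT) a i j.
Proof.
move=> a0; rewrite !esum_esum//.
rewrite (@reindex_esum R _ _ ([set: J] `*`` (fun=> [set: I])) _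
  (fun k => (k.2, k.1)))//.
by split => //= [[i j] [i' j'] _ _ /= [-> ->]|[i j] _] //; exists (j, i).
Qed.

Section expected_value_operator.
Context (R : realType) (M : choiceType) (C : Type) (p : M -> R).
Context (next : C -> M -> C).
Hypothesis p_ge0 : forall m, (0 <= p m)%R.
Hypothesis p_sum1 : \esum_(m in setT) (p m)%:E = 1.

Definition expect_next (f : C -> \bar R) (w : C) : \bar R :=
  \esum_(m in setT) ((p m)%:E * f (next w m)).
Local Notation K := expect_next.

Lemma expect_next_ge0 f w : (forall w', 0 <= f w') -> 0 <= K f w.
Proof. by move=> f0; apply: esum_ge0 => m _; rewrite mule_ge0 ?lee_fin. Qed.

Lemma iter_expect_next_ge0 n f : (forall w, 0 <= f w) ->
  forall w, 0 <= iter n K f w.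
Proof. by move=> f0; elim: n => //= n IH w; exact: expect_next_ge0. Qed.

(** Comparing at samples of positive mass is what lets finiteness of [H], which propagates only
    along such samples, be carried through iterations. *)
Lemma le_expect_next f g w :
  (forall m, (0 < p m)%R -> f (next w m) <= g (next w m)) -> K f w <= K g w.
Proof.
move=> fg; apply: le_esum => m _.
have := p_ge0 m; rewrite le_eqVlt => /predU1P[<-|pm]; first by rewrite !mul0e.
by rewrite lee_wpmul2l ?fg ?lee_fin ?ltW.
Qed.

Lemma expect_nextD f g w : (forall w', 0 <= f w') -> (forall w', 0 <= g w') ->
  K (fun w' => f w' + g w') w = K f w + K g w.
Proof.
move=> f0 g0; rewrite -esumD => [|m _|m _]; rewrite ?mule_ge0 ?lee_fin//.
by apply: eq_esum => m _; rewrite ge0_muleDr.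
Qed.

Lemma expect_nextZ x f w : (0 <= x)%R -> (forall w', 0 <= f w') ->
  K (fun w' => x%:E * f w') w = x%:E * K f w.
Proof.
move=> x0 f0; rewrite -esumZl// => [|m]; last by rewrite mule_ge0 ?lee_fin.
by apply: eq_esum => m _; rewrite muleCA.
Qed.

Lemma expect_next_cst x f w : 0 <= x -> (forall m, f (next w m) = x) ->
  K f w = x.
Proof.
move=> x0 fx; transitivity (\esum_(m in [set: M]) ((p m)%:E * x)).
  by apply: eq_esum => m _; rewrite fx.
case: x x0 {fx} => [x x0|_|//].
  rewrite -[RHS]mule1 -p_sum1 -esumZl//.
  by apply: eq_esum => m _; rewrite muleC.
(* For [x = +oo], since [0 * +oo = 0], some sample must have positive mass; total mass 1 provides
   one. *)
have [[m pm]|/forallNP p0] := pselect (exists m, (0 < p m)%R).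
  apply/eqP; rewrite -leye_eq; apply: esum_ge.
  by exists [set m]; rewrite ?fsbig_set1 ?gt0_muley.
have := p_sum1; rewrite esum1 => [/esym/eqP|m _]; first by rewrite onee_eq0.
by apply/eqP; rewrite eqe eq_le p_ge0 leNgt andbT; exact/negP/p0.
Qed.

(** Monotone convergence, here an exchange of two nonnegative sums. *)
Lemma expect_next_nneseries (f : nat -> C -> \bar R) w :
  (forall k w', 0 <= f k w') ->
  K (fun w' => \sum_(0 <= k <oo) f k w') w = \sum_(0 <= k <oo) K (f k) w.
Proof.
move=> f0; rewrite nneseries_esumT => [|k]; last exact: expect_next_ge0.
rewrite exchange_esum => [|k m]; last by rewrite mule_ge0 ?lee_fin.
by apply: eq_esum => m _; rewrite esumZl ?nneseries_esumT.
Qed.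

Lemma iter_expect_next_nneseries n (f : nat -> C -> \bar R) w :
  (forall k w', 0 <= f k w') ->
  iter n K (fun w' => \sum_(0 <= k <oo) f k w') w =
  \sum_(0 <= k <oo) iter n K (f k) w.
Proof.
move=> f0; elim: n w => //= n IH w; rewrite (funext IH) expect_next_nneseries//.
by move=> k w'; exact: iter_expect_next_ge0.
Qed.

Lemma expect_next_pinfty f w m : (forall w', 0 <= f w') -> K f w < +oo ->
  (0 < p m)%R -> f (next w m) < +oo.
Proof.
move=> f0 Kf pm; rewrite ltey; apply: contraTneq Kf => foo.
rewrite -leNgt leye_eq; apply/eqP/eqP; rewrite -leye_eq; apply: esum_ge.
exists [set m]; first by split.
by rewrite fsbig_set1 foo gt0_muley.
Qed.

(** * Drift bounds on the expected halting time *)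

Section drift.
Context (halted : pred C) (H : C -> \bar R) (eps delta zeta : R).
Hypotheses (eps_gt0 : (0 < eps)%R) (delta_ge0 : (0 <= delta)%R)
  (zeta_ge0 : (0 <= zeta)%R).
Hypothesis H_ge0 : forall w, 0 <= H w.
Hypothesis H_halted : forall w, halted w -> H w = 0.
Hypothesis next_halted : forall w m, halted w -> halted (next w m).
Hypothesis H_decr : forall w, ~~ halted w -> eps%:E + K H w <= H w.
Hypothesis H_decr_le : forall w, ~~ halted w -> H w < +oo ->
  H w <= delta%:E + K H w.
Hypothesis H_diff_le : forall w, ~~ halted w -> H w < +oo ->
  K (fun w' => `|H w' - H w|) w <= zeta%:E.

Definition running (w : C) : \bar R := (~~ halted w)%:R%:E.

(** The k-th term is the probability of still running after k steps, so the sum of these tails is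
    the expected number of steps before halting. *)
Definition expected_time (w : C) : \bar R :=
  \sum_(0 <= k <oo) iter k K running w.

(** The expectation of the halting time truncated at n. *)
Let V n w := \sum_(0 <= k < n) iter k K running w.

Let running_ge0 w : 0 <= running w. Proof. by rewrite lee_fin. Qed.

Let Krunning_ge0 k w : 0 <= iter k K running w.
Proof. exact: iter_expect_next_ge0. Qed.

Let V_ge0 n w : 0 <= V n w.
Proof. by apply: sume_ge0. Qed.

Let VS n w : V n.+1 w = running w + K (V n) w.
Proof.
rewrite /V big_nat_recl//; congr (_ + _).
rewrite -esum_sum => [|m k _ _]; last first.
  by rewrite mule_ge0 ?lee_fin//; exact: Krunning_ge0.
by apply: eq_esum => m _; rewrite ge0_sume_distrr// => k _; exact: Krunning_ge0.
Qed.

Let V_le n w : V n w <= expected_time w.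
Proof. exact: nneseries_lim_ge. Qed.

Let K_halted f w : (forall w', halted w' -> f w' = 0) -> halted w -> K f w = 0.
Proof. by move=> f0 hw; apply: esum1 => m _; rewrite f0 ?mule0 ?next_halted. Qed.

Let iter_halted k w : halted w -> iter k K running w = 0.
Proof.
elim: k w => [|k IH] w hw /=; first by rewrite /running hw.
by rewrite K_halted.
Qed.

Let H_next w m : H w < +oo -> (0 < p m)%R -> H (next w m) < +oo.
Proof.
move=> Hw; have [hw _|hw] := boolP (halted w).
  by rewrite H_halted ?ltry ?next_halted.
apply: expect_next_pinfty => //; apply: le_lt_trans Hw.
apply: le_trans (H_decr hw); rewrite leeDr//.
by rewrite lee_fin ltW.
Qed.

(** Each running step consumes at least [eps] of the expected value of [H], which stays nonnegative;
    hence [eps * V n <= H] for all n, and n tends to infinity. *)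
Let expected_time_fin w : H w < +oo -> expected_time w < +oo.
Proof.
move=> Hw; suff h n w' : eps%:E * V n w' <= H w'.
  apply: (@le_lt_trans _ _ (eps^-1%:E * H w)); last first.
    by rewrite lte_mul_pinfty// lee_fin invr_ge0 ltW.
  apply: lime_le; first exact: is_cvg_nneseries.
  by apply: nearW => n; rewrite lee_pdivlMl//; exact: h.
elim: n w' => [|n IH] w'; first by rewrite /V big_nil mule0.
rewrite VS; have [hw|hw] := boolP (halted w').
  rewrite /running hw add0e K_halted ?mule0// => w'' hw''.
  by rewrite /V big1// => k _; exact: iter_halted.
apply: le_trans (H_decr hw).
rewrite ge0_muleDr ?expect_next_ge0 ?V_ge0// /running hw mule1 leeD2l//.
rewrite -(expect_nextZ _ (ltW eps_gt0) (V_ge0 n)).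
by apply: le_expect_next => m _; exact: IH.
Qed.

(* If the run has halted after N steps then H has reached 0, so that x is at
   most |x - H w| plus the total variation of H along the run. *)
Let hitting_cost (x : R) N w : (0 <= x)%R -> H w < +oo ->
  x%:E <= `|x%:E - H w| + zeta%:E * V N w + x%:E * iter N K running w.
Proof.
move=> x0; elim: N w => [|N IH] w Hw.
  have [hw|hw] := boolP (halted w).
    rewrite H_halted// sube0 /V big_nil mule0 /= /running hw mule0 !adde0.
    by rewrite lee_fin ler_norm.
  by rewrite /= /running hw mule1 leeDr// adde_ge0 ?mule_ge0 ?lee_fin.
have [hw|hw] := boolP (halted w).
  rewrite H_halted// sube0 -addeA; apply: (@le_trans _ _ `|x%:E|).
    by rewrite lee_fin ler_norm.
  by rewrite leeDl// adde_ge0 ?mule_ge0 ?lee_fin.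
rewrite VS {1}/running hw ge0_muleDr ?expect_next_ge0 ?V_ge0// mule1 addeA.
(* The induction hypothesis is averaged over the first step. The triangle inequality through [H w]
   isolates the increment of [H], whose mean [zeta] bounds. *)
apply: (@le_trans _ _ (K (fun w' => `|x%:E - H w| + `|H w' - H w| +
    zeta%:E * V N w' + x%:E * iter N K running w') w)).
  rewrite -{1}(@expect_next_cst x%:E (fun=> x%:E) w)//.
  apply: le_expect_next => m pm; have Hm := H_next Hw pm.
  apply: le_trans (IH _ Hm) _; rewrite !leeD2r//.
  rewrite -(@fineK _ (H w)) ?ge0_fin_numE//.
  rewrite -(@fineK _ (H (next w m))) ?ge0_fin_numE//.
  rewrite -!EFinB !abse_EFin -EFinD lee_fin.
  by rewrite (distrC (fine (H (next w m)))) ler_distD.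
rewrite expect_nextD; last 2 first.
- by move=> w'; rewrite !adde_ge0 ?mule_ge0 ?lee_fin.
- by move=> w'; rewrite mule_ge0 ?lee_fin.
rewrite expect_nextD; last 2 first.
- by move=> w'; rewrite !adde_ge0.
- by move=> w'; rewrite mule_ge0 ?lee_fin.
rewrite expect_nextD//.
rewrite !expect_nextZ// leeD2r// leeD2r// leeD ?H_diff_le//.
rewrite -(@fineK _ (H w)) ?ge0_fin_numE// -EFinB abse_EFin.
by rewrite (@expect_next_cst `|x - fine (H w)|%:E).
Qed.

Let tail_cvg w : H w < +oo ->
  \sum_(n <= k <oo) iter k K running w @[n --> \oo] --> 0.
Proof. by move=> Hw; apply: nneseries_tail_cvg; [exact: expected_time_fin|]. Qed.

(** Take [x = H w] in [hitting_cost]: the distance term vanishes, and the probability of running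
    after N steps tends to 0, being at most the tail from N of a convergent series. *)
Let H_le_time w : H w < +oo -> H w <= zeta%:E * expected_time w.
Proof.
move=> Hw; have Hfin : H w \is a fin_num by rewrite ge0_fin_numE.
have cv : (zeta%:E * expected_time w +
    H w * \sum_(n <= k <oo) iter k K running w) @[n --> \oo] -->
    zeta%:E * expected_time w + H w * 0.
  apply: cvgeD; [by rewrite mule0 fin_num_adde_defl|exact: cvg_cst|].
  by apply: cvgeZl => //; exact: tail_cvg.
rewrite mule0 adde0 in cv; apply: cvge_ge cv; apply: nearW => N.
rewrite -(fineK Hfin).
apply: le_trans (@hitting_cost (fine (H w)) N w _ Hw) _; first exact: fine_ge0.
rewrite fineK// subee// abse0 add0e leeD//; first by rewrite lee_wpmul2l ?lee_fin.
rewrite lee_wpmul2l// (@nneseries_split _ _ N 1)//.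
by rewrite addn1 big_nat1 leeDl// nneseries_ge0.
Qed.

Let iter_K_le f g n w : (forall w', H w' < +oo -> f w' <= g w') ->
  H w < +oo -> iter n K f w <= iter n K g w.
Proof.
move=> fg; elim: n w => [|n IH] w Hw /=; first exact: fg.
by apply: le_expect_next => m pm; apply/IH/H_next.
Qed.

(** Unrolls [H_decr_le] n times; the last term is the mean of [H] left after n steps. *)
Let H_le_partial n w : H w < +oo -> H w <= delta%:E * V n w + iter n K H w.
Proof.
elim: n w => [|n IH] w Hw; first by rewrite /V big_nil mule0 add0e.
have [hw|hw] := boolP (halted w).
  by rewrite H_halted// adde_ge0 ?iter_expect_next_ge0// mule_ge0 ?lee_fin ?V_ge0.
apply: le_trans (H_decr_le hw Hw) _.
rewrite VS /running hw ge0_muleDr ?expect_next_ge0 ?V_ge0// mule1 -addeA leeD2l//.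
rewrite -expect_nextZ// /= -expect_nextD; last 2 first.
- by move=> w'; rewrite mule_ge0 ?lee_fin ?V_ge0.
- by move=> w'; exact: iter_expect_next_ge0.
by apply: le_expect_next => m pm; apply/IH/H_next.
Qed.

Lemma le_expected_time w : H w < +oo -> H w <= delta%:E * expected_time w.
Proof.
move=> Hw.
have cv : (delta%:E * expected_time w +
    zeta%:E * \sum_(n <= k <oo) iter k K running w) @[n --> \oo] -->
    delta%:E * expected_time w + zeta%:E * 0.
  apply: cvgeD; [by rewrite mule0 fin_num_adde_defl|exact: cvg_cst|].
  by apply: cvgeZl => //; exact: tail_cvg.
rewrite mule0 adde0 in cv; apply: cvge_ge cv; apply: nearW => n.
apply: le_trans (H_le_partial n Hw) _; apply: leeD.
  by rewrite lee_wpmul2l ?lee_fin.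
apply: le_trans (iter_K_le n (fun w' => @H_le_time w') Hw) _.
have -> : iter n K (fun w' => zeta%:E * expected_time w') w =
    zeta%:E * iter n K expected_time w.
  elim: n w {Hw} => //= n IH w; rewrite (funext IH) expect_nextZ// => w'.
  by apply: iter_expect_next_ge0 => w''; exact: nneseries_ge0.
(* Applying [K] n times shifts the index of the series by n, which leaves exactly its tail from
   n. *)
rewrite iter_expect_next_nneseries// -(nneseries_addn n)//.
by under [X in _ <= _ * X]eq_eseriesr do rewrite addnC iterD.
Qed.

End drift.
End expected_value_operator.

(** * Probability measures on runs *)

Local Close Scope ereal_scope.

Section nested_intervals.
(* Histories are reversed: the head is the most recent state, and [q r] is the
   law of the state that follows the history r. *)
Context (R : realType) (S : countType) (s0 : S) (q : seq S -> S -> R).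
Hypothesis q_ge0 : forall r s, 0 <= q r s.
Hypothesis q_sum1 : forall r, (\esum_(s in setT) (q r s)%:E = 1)%E.

Fixpoint hist_prob (r : seq S) : R :=
  if r is s :: r' then hist_prob r' * q r' s else 1.

Let qn (r : seq S) (n : nat) : R := oapp (q r) 0 (pickle_inv n).

Let cumul (r : seq S) (n : nat) : R := \sum_(0 <= i < n) qn r i.

(** The interval of [r'] is cut into consecutive pieces, one per next state in the order of the
    codes given by [pickle]; integers coding no state have mass 0 in [qn]. *)
Fixpoint hist_left (r : seq S) : R :=
  if r is s :: r' then hist_left r' + hist_prob r' * cumul r' (pickle s) else 0.

(** Half-open, so that the pieces tile their parent without overlap and a history of probability 0
    gets the empty set. *)
Definition hist_itv (r : seq S) : set R :=
  `[hist_left r, hist_left r + hist_prob r[%classic.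

Lemma hist_prob_ge0 r : 0 <= hist_prob r.
Proof. by elim: r => //= s r IH; rewrite mulr_ge0. Qed.

Let qn_ge0 r n : 0 <= qn r n.
Proof. by rewrite /qn; case: pickle_inv => //=. Qed.

Let qn_pickle r s : qn r (pickle s) = q r s.
Proof. by rewrite /qn pickleK_inv. Qed.

Let cumulS r n : cumul r n.+1 = cumul r n + qn r n.
Proof. by rewrite /cumul big_nat_recr. Qed.

Let cumul_mono r m n : (m <= n)%N -> cumul r m <= cumul r n.
Proof.
move=> mn; rewrite /cumul (big_cat_nat _ mn)//= lerDl.
by apply: sumr_ge0.
Qed.

Let qn_sum1 r : (\sum_(0 <= i <oo) (qn r i)%:E = 1)%E.
Proof.
rewrite nneseries_esumT => [|n]; last by rewrite lee_fin.
rewrite -(q_sum1 r).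
transitivity (\esum_(n in pickle @` [set: S]) (qn r n)%:E)%E.
  rewrite [RHS]esum_mkcond; apply: eq_esum => n _; case: ifPn => // /negP hn.
  rewrite /qn; case E: (pickle_inv n : option S) => [s|//]; case: hn.
  apply/mem_set; exists s => //.
  by have := @pickle_invK S n; rewrite /ocancel E.
rewrite esum_image; first by apply: eq_esum => s _; rewrite qn_pickle.
by move=> s t _ _ /(pcan_inj pickleK_inv).
Qed.

Let cumul_le1 r n : cumul r n <= 1.
Proof.
rewrite -lee_fin -(qn_sum1 r) /cumul -sumEFin.
by apply: nneseries_lim_ge => i _ _; rewrite lee_fin.
Qed.

Let cumul_gt r y : y < 1 -> exists n, y < cumul r n.
Proof.
move=> y1; apply: contrapT => /forallNP h.
suff : (1 <= y%:E)%E by rewrite lee_fin leNgt y1.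
rewrite -(qn_sum1 r); apply: lime_le.
  by apply: is_cvg_nneseries => n _ _; rewrite lee_fin.
apply: nearW => n; rewrite sumEFin lee_fin leNgt.
exact/negP/h.
Qed.

Let hist_itv_sub s r : hist_itv (s :: r) `<=` hist_itv r.
Proof.
move=> x; rewrite /hist_itv/= !in_itv/= => /andP[lx xr]; apply/andP; split.
  apply: le_trans lx; rewrite lerDl mulr_ge0 ?hist_prob_ge0//.
  by apply: sumr_ge0.
apply: lt_le_trans xr _.
rewrite -addrA lerD2l -mulrDr -qn_pickle -cumulS ler_piMr ?hist_prob_ge0//.
Qed.

(** If the code of [s] is smaller than that of [t], the piece of [s] ends no later than the piece of
    [t] begins. *)
Let hist_itv_inj s t r x : hist_itv (s :: r) x -> hist_itv (t :: r) x -> s = t.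
Proof.
wlog st : s t / (pickle s <= pickle t)%N.
  move=> h; have [|/ltnW] := leqP (pickle s) (pickle t); first exact: h.
  by move=> /h h' /h' h'' /h'' ->.
rewrite /hist_itv/= !in_itv/= => /andP[_ xs] /andP[xt _].
apply: (pcan_inj pickleK_inv); apply/eqP; rewrite eqn_leq st /=.
rewrite leqNgt; apply/negP => lt_st.
have := le_lt_trans xt xs; rewrite ltNge => /negP; apply.
rewrite -addrA lerD2l -mulrDr -qn_pickle -cumulS.
by rewrite ler_wpM2l ?hist_prob_ge0 ?cumul_mono.
Qed.

(** Let n+1 be the least index at which [cumul] exceeds the relative position of [x]; it is not 0 as
    [cumul r 0 = 0]. Then [cumul] jumps at n, so n codes a state, and the piece of that state
    contains [x]. *)
Let hist_itv_cover r x : hist_itv r x -> exists s, hist_itv (s :: r) x.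
Proof.
rewrite /hist_itv/= in_itv/= => /andP[lx xr].
have p_gt0 : 0 < hist_prob r.
  by rewrite -(ltrDl (hist_left r)) (le_lt_trans lx).
have [n0] : exists n, (x - hist_left r) / hist_prob r < cumul r n.
  by apply: cumul_gt; rewrite ltr_pdivrMr// mul1r ltrBlDl.
rewrite ltr_pdivrMr// ltrBlDl => xn0.
have ex : exists n, x < hist_left r + cumul r n * hist_prob r by exists n0.
case: (ex_minnP ex) => -[|n] xn nmin.
  by move: xn; rewrite /cumul big_nil mul0r addr0 ltNge lx.
have nx : hist_left r + cumul r n * hist_prob r <= x.
  by rewrite leNgt; apply/negP => /nmin; rewrite ltnn.
case E : (pickle_inv n : option S) => [s|]; last first.
  by move: (le_lt_trans nx xn); rewrite cumulS /qn E/= addr0 ltxx.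
have Es : pickle s = n by move: (@pickle_invK S n); rewrite /ocancel E.
exists s; rewrite /hist_itv/= in_itv/= Es mulrC nx/=.
by rewrite -qn_pickle Es -addrA (mulrC (cumul _ _)) -mulrDr -cumulS mulrC.
Qed.

(** Descends through the nested intervals containing [x]. For [x] in [[0, 1[] the choice exists and
    is unique at each level; elsewhere the default [s0] is returned. *)
Fixpoint itv_hist (x : R) (n : nat) : seq S :=
  if n is m.+1 then
    xget s0 [set s | hist_itv (s :: itv_hist x m) x] :: itv_hist x m
  else [::].

Definition itv_run (x : R) (n : nat) : S := head s0 (itv_hist x n.+1).

Lemma rev_mkseq_itv_run x n : rev (mkseq (itv_run x) n) = itv_hist x n.
Proof. by elim: n => //= n IH; rewrite mkseqS rev_rcons IH. Qed.

Lemma itv_run_hist r :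
  [set x | 0 <= x < 1 /\ mkseq (itv_run x) (size r) = rev r] = hist_itv r.
Proof.
have -> : [set x | 0 <= x < 1 /\ mkseq (itv_run x) (size r) = rev r] =
    [set x | 0 <= x < 1 /\ itv_hist x (size r) = r].
  apply/seteqP; split=> x /= [-> E]; split => //.
    by rewrite -rev_mkseq_itv_run E revK.
  by rewrite -[LHS]revK rev_mkseq_itv_run E.
elim: r => [|s r IH] /=.
  apply/seteqP; split => x /=; rewrite /hist_itv/= add0r in_itv/=; first by case.
  by [].
apply/seteqP; split=> x /=.
  move=> [x01 [Es Er]]; rewrite Er in Es.
  have /hist_itv_cover ex : hist_itv r x by rewrite -IH.
  by rewrite -Es; exact: (xgetPex s0 ex).
move=> sx; have := hist_itv_sub sx; rewrite -{1}IH => -[x01 Er]; split => //.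
rewrite Er; congr cons; apply: xget_unique => // t tx.
exact: hist_itv_inj tx sx.
Qed.

End nested_intervals.

Section unit_itv_measure.
Context (R : realType).

Definition unit_itv_measure : set (measurableTypeR R) -> \bar R :=
  mrestr lebesgue_measure (measurable_itv `[0%R, 1%R[).

HB.instance Definition _ := Measure.on unit_itv_measure.

Let unit_itv_measureT : unit_itv_measure [set: _] = 1%:E.
Proof.
rewrite /unit_itv_measure /mrestr setTI lebesgue_measure_itv/= lte_fin ltr01.
by rewrite oppr0 adde0.
Qed.

HB.instance Definition _ :=
  Measure_isProbability.Build _ _ _ unit_itv_measure unit_itv_measureT.

End unit_itv_measure.

(** * The law of the runs as an image of Lebesgue measure *)

Section run_measure.
Context (R : realType) (W : program) (q : seq (state W) -> state W -> R).
Hypothesis q_ge0 : forall r s, 0 <= q r s.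
Hypothesis q_sum1 : forall r, (\esum_(s in setT) (q r s)%:E = 1)%E.

(** Makes the map to runs constant outside [[0, 1[], so that it is measurable on the whole line. *)
Let clamp (x : R) : R := if 0 <= x < 1 then x else 0.

Let X (x : measurableTypeR R) : runs W := itv_run (state0 W) q (clamp x).

Let X_cylinder H :
  X @^-1` cylinder H `&` `[0, 1[%classic = hist_itv q (rev H).
Proof.
rewrite -(itv_run_hist (state0 W) q_ge0 q_sum1) revK size_rev.
apply/seteqP; split => x /=; rewrite /X /clamp /cylinder/= in_itv/=.
  by move=> [+ x01]; rewrite x01.
by move=> [x01]; rewrite x01.
Qed.

Let X_outside H : ~` `[0, 1[%classic `<=` X @^-1` cylinder H \/
  ~` `[0, 1[%classic `&` X @^-1` cylinder H = set0.
Proof.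
(* The point 1 is outside [[0, 1[] and stands for the constant value taken there. *)
have h x : (~` `[0, 1[%classic) x -> X x = X 1.
  by move=> /= /negP; rewrite in_itv/= /X /clamp ltxx andbF => /negbTE ->.
have [X1|X1] := pselect (cylinder H (X 1)).
  by left=> x /h /= ->.
by right; apply/seteqP; split => x //= [/h ->].
Qed.

(** It suffices to check cylinders: the preimage of one is an interval together with all or none of
    the complement of [[0, 1[]. *)
Let measurable_X : measurable_fun setT X.
Proof.
have := @measurability _ _ (measurableTypeR R) (runs W) setT X
  (range (@cylinder W)); apply => //.
move=> _ [_ [H _ <-] <-]; rewrite setTI.
rewrite -(setIT (X @^-1` _)) -(setUv `[0, 1[%classic) setIUr X_cylinder.
apply: measurableU; first exact: measurable_itv.
have [/setIidl E|E] := X_outside H; rewrite setIC E//.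
by apply: measurableC; exact: measurable_itv.
Qed.

Lemma run_measure : exists P : probability (runs W) R,
  forall H, P (cylinder H) = (hist_prob q (rev H))%:E.
Proof.
exists (distribution (@unit_itv_measure R) (mfun_Sub (mem_set measurable_X))) => H.
rewrite /distribution /pushforward /= /unit_itv_measure /mrestr X_cylinder.
rewrite lebesgue_measure_itv/= lte_fin.
(* The length formula for an interval tests whether its endpoints are strictly ordered, hence the
   separate case of probability 0. *)
have := hist_prob_ge0 q_ge0 (rev H); rewrite le_eqVlt => /predU1P[<-|p0].
  by rewrite addr0 ltxx.
by rewrite ltrDl p0 -EFinB addrC addKr.
Qed.

End run_measure.

Local Open Scope ereal_scope.

(** * Memoryless schedulers *)

Lemma trans_ge0 (R : realType) (W : program) (U : sampling R W) a s s' :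
  (0 <= trans U a s s')%R.
Proof. by rewrite /trans; case: ifP => // _; exact: joint_ge0. Qed.

(** Transitions from [s] under [a] are supported on the image of the samples, and distinct samples
    give distinct states because the state records the sample. *)
Lemma esum_trans (R : realType) (W : program) (U : sampling R W) a s
    (f : state W -> \bar R) : enabled s a ->
  \esum_(s' in setT) ((trans U a s s')%:E * f s') =
  \esum_(mu in setT) ((joint U mu)%:E * f (next_config s.1 a mu, mu)).
Proof.
move=> ea; pose e mu : state W := (next_config s.1 a mu, mu).
transitivity (\esum_(s' in e @` setT) ((joint U s'.2)%:E * f s')).
  rewrite [RHS]esum_mkcond; apply: eq_esum => s' _; rewrite /trans ea/=.
  case: ifPn => [/eqP E|E].
    by rewrite mem_set//; exists s'.2 => //; case: s' E => /= w mu ->.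
  rewrite memNset ?mul0e// => -[mu _ es].
  by move: E; rewrite -es /= eqxx.
by rewrite esum_image// => mu nu _ _ [_ ->].
Qed.

Section memoryless_scheduler.
Context (R : realType) (W : program) (U : sampling R W) (c : nselem W).
Context (best : config W -> action).
Hypothesis best_enabled : forall s : state W, enabled s (best s.1).

Definition sched_of (H : seq (state W)) (a : action) : R :=
  (a == best (last (state0 W) H).1)%:R.

Lemma sched_of_ge0 H a : history U H -> (0 <= sched_of H a)%R.
Proof. by rewrite /sched_of. Qed.

Lemma sched_of_sum1 H : history U H -> (\sum_a sched_of H a)%R = 1%R.
Proof.
move=> _; rewrite (bigD1 (best (last (state0 W) H).1))//= /sched_of eqxx.
by rewrite big1 ?addr0// => a /negbTE ->.
Qed.

Lemma sched_of_enabled H a : history U H ->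
  ~~ enabled (last (state0 W) H) a -> sched_of H a = 0%R.
Proof.
move=> _ na; rewrite /sched_of; case: eqP => // E.
by rewrite E best_enabled in na.
Qed.

Definition memoryless : scheduler U :=
  Scheduler sched_of_ge0 sched_of_sum1 sched_of_enabled.

Let s_init : state W := ([:: c], [ffun=> 0%R]).

(** The empty history is followed by the initial state, so the initial law counts as one more step
    of the kernel. *)
Definition hist_kernel (r : seq (state W)) (s : state W) : R :=
  if r is s' :: _ then trans U (best s'.1) s' s else (s == s_init)%:R.

Lemma hist_kernel_ge0 r s : (0 <= hist_kernel r s)%R.
Proof. by case: r => [|s' r] /=; [exact: ler0n|exact: trans_ge0]. Qed.

Lemma esum_hist_kernel_nil (f : state W -> \bar R) : (forall s, 0 <= f s) ->
  \esum_(s in setT) ((hist_kernel [::] s)%:E * f s) = f s_init.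
Proof.
move=> f0; rewrite -[RHS](@esum_set1 _ _ s_init)// [RHS]esum_mkcond.
apply: eq_esum => s _ /=; case: eqP => [->|ne].
  by rewrite mem_set// mul1e.
by rewrite memNset ?mul0e.
Qed.

Lemma hist_kernel_sum1 r : \esum_(s in setT) (hist_kernel r s)%:E = 1.
Proof.
transitivity (\esum_(s in setT) ((hist_kernel r s)%:E * 1)).
  by apply: eq_esum => s _; rewrite mule1.
case: r => [|s r]; first by rewrite (@esum_hist_kernel_nil (fun=> 1)).
rewrite (@esum_trans _ _ _ _ _ (fun=> 1))// -[RHS](esum_joint U).
by apply: eq_esum => mu _; rewrite mule1.
Qed.

Lemma hist_prob_cylinder H : H != [::] ->
  hist_prob hist_kernel (rev H) = cylinder_prob memoryless c H.
Proof.
elim/last_ind: H => // H s IH _; rewrite rev_rcons /=.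
case/lastP: H IH => [_|H t IH].
  by rewrite /cylinder_prob /= big_ord0 mulr1 mul1r.
rewrite {}IH; last by rewrite -size_eq0 size_rcons.
rewrite rev_rcons /= /cylinder_prob; set H' := rcons H t.
have sH : size (rcons H' s) = (size H).+2 by rewrite !size_rcons.
have sH' : size H' = (size H).+1 by rewrite size_rcons.
rewrite sH sH' /= big_ord_recr /= mulrA; congr (_ * _ * _)%R.
- by rewrite nth_rcons sH'.
- apply: eq_bigr => i _; apply: eq_bigr => a _.
  have iH : (i < size H)%N by [].
  rewrite !(nth_rcons _ H') sH' ltnS ltnW//= ltnS iH.
  by rewrite -[rcons H' s]cats1 takel_cat// sH' ltnS ltnW.
(* The scheduler is a Dirac mass, so the sum over actions reduces to the action [best t.1]. *)
- rewrite (bigD1 (best t.1))//= big1 ?addr0 => [|a ab]; last first.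
    rewrite /sched_of -sH' -[rcons H' s]cats1 take_size_cat//.
    by rewrite last_rcons (negbTE ab) mul0r.
  rewrite /sched_of -{1}sH' -[rcons H' s]cats1 take_size_cat//.
  rewrite last_rcons eqxx mul1r cats1 !nth_rcons sH' ltnSn ltnn eqxx.
  by rewrite ltnn eqxx.
Qed.

Definition next_best (w : config W) (mu : valuation (svar W)) : config W :=
  next_config w (best w) mu.
Local Notation K := (expect_next (joint U) next_best).

Definition alive (n : nat) : set (seq (state W)) :=
  [set r | size r = n /\ all (fun s => s.1 != [::]) r].

(** A history of n+1 states has made n steps. Summing out its most recent state applies [K] once;
    the histories that reach the empty stack contribute nothing, since [f] vanishes there and that
    stack is absorbing. *)
Lemma esum_alive n (f : config W -> \bar R) :
  (forall w, 0 <= f w) -> f [::] = 0 ->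
  \esum_(r in alive n.+1)
    ((hist_prob hist_kernel r)%:E * f (head (state0 W) r).1) =
  iter n K f [:: c].
Proof.
have step m g : (forall w, 0 <= g w) -> g [::] = 0 ->
    \esum_(r in alive m.+1)
      ((hist_prob hist_kernel r)%:E * g (head (state0 W) r).1) =
    \esum_(r in alive m) ((hist_prob hist_kernel r)%:E *
      \esum_(s in setT) ((hist_kernel r s)%:E * g s.1)).
  move=> g0 gnil.
  pose e (k : seq (state W) * state W) := k.2 :: k.1.
  rewrite (@reindex_esum _ _ _
    (alive m `*`` (fun=> [set s : state W | s.1 != [::]])) _ e); last first.
    split.
    - by move=> [r s] [[/= sr ar] sn]; split => /=; [rewrite sr|rewrite sn].
    - by move=> [r s] [r' s'] _ _ [-> ->].
    - move=> [|s r] [//= [sr] /andP[sn ar]]; exists (r, s) => //.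
  transitivity (\esum_(r in alive m) \esum_(s in [set s : state W | s.1 != [::]])
      ((hist_prob hist_kernel r)%:E * ((hist_kernel r s)%:E * g s.1))).
    rewrite esum_esum => [|r s _ _].
      by apply: eq_esum => -[r s] _ /=; rewrite EFinM muleA.
    rewrite !mule_ge0 ?lee_fin//; first exact: hist_prob_ge0 hist_kernel_ge0 _.
    exact: hist_kernel_ge0.
  apply: eq_esum => r _; rewrite esumZl; last 2 first.
  - exact: hist_prob_ge0 hist_kernel_ge0 _.
  - by move=> s; rewrite mule_ge0 ?lee_fin ?hist_kernel_ge0.
  congr (_ * _); rewrite esum_mkcond; apply: eq_esum => s _; case: ifPn => //.
  by rewrite notin_setE /= => /negP; rewrite negbK => /eqP ->; rewrite gnil mule0.
elim: n f => [|n IH] f f0 fnil.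
  rewrite step// (_ : alive 0 = [set [::]]); last first.
    by apply/seteqP; split => r /=; [case=> /size0nil|move=> ->].
  rewrite esum_set1 /= mul1e (@esum_hist_kernel_nil (fun s => f s.1))//.
rewrite step// iterSr -IH; last 2 first.
- by move=> w; apply: expect_next_ge0 => //; exact: joint_ge0.
- by apply: esum1 => mu _; rewrite fnil mule0.
apply: eq_esum => -[|s r] [//= _ _].
by rewrite (@esum_trans _ _ _ _ _ (fun s => f s.1)).
Qed.

(** * The termination time as a sum of indicators *)

Definition not_yet (n : nat) : set (runs W) :=
  [set rho | forall j, (j <= n)%N -> (rho j).1 != [::]].

Lemma cylinder_measurable H : measurable (cylinder H : set (runs W)).
Proof. by apply: sub_sigma_algebra; exists H. Qed.

Lemma not_yetE n :
  not_yet n = \bigcup_(r in alive n.+1) (cylinder (rev r) : set (runs W)).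
Proof.
apply/seteqP; split => rho /=.
  move=> h; exists (rev (mkseq rho n.+1)); last by rewrite /cylinder/= revK size_mkseq.
  split; first by rewrite size_rev size_mkseq.
  by rewrite all_rev; apply/allP => s /mapP[j]; rewrite mem_iota => jn ->; exact: h.
move=> [r [sr ar]]; rewrite /cylinder/= size_rev sr => E j jn.
move: ar; rewrite -all_rev -E => /allP; apply.
by apply: map_f; rewrite mem_iota.
Qed.

Lemma not_yet_measurable n : measurable (not_yet n).
Proof.
rewrite not_yetE bigcup_mkcond; apply: countable_bigcupT_measurable => // r.
by case: ifP => // _; exact: cylinder_measurable.
Qed.

(** The time T is the number of n with [T > n]: if the stack first empties at n, exactly the terms
    of index below n equal 1; if it never does, all terms do. *)
Lemma termination_timeE (rho : runs W) :
  termination_time R rho = \sum_(0 <= n <oo) (\1_(not_yet n) rho)%:E.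
Proof.
have ind0 n : 0 <= (\1_(not_yet n) rho)%:E :> \bar R by rewrite lee_fin.
have [ex|nex] := pselect (exists n, (rho n).1 == [::]).
  case: (ex_minnP ex) => n /eqP rn nmin.
  rewrite (@nneseries_split _ _ 0 n)// add0n [X in _ + X]eseries0 ?adde0; last first.
    move=> k nk _; rewrite indicE memNset// => /(_ _ nk).
    by rewrite rn eqxx.
  rewrite (@eq_big_nat _ _ _ _ _ _ (fun=> 1)) => [|k /andP[_ kn]]; last first.
    rewrite indicE mem_set// => j jk; apply/negP => /nmin.
    by rewrite leqNgt (leq_ltn_trans jk kn).
  rewrite sumEFin sumr_const_nat subn0 /termination_time.
  apply/eqP; rewrite eq_le; apply/andP; split.
    by apply: ereal_inf_lbound; exists n.
  apply: le_ereal_inf_tmp => _ [m /= rm <-]; rewrite lee_fin ler_nat.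
  by apply: nmin; rewrite rm.
rewrite /termination_time.
rewrite (_ : [set n : nat | _] = set0) ?image_set0 ?ereal_inf0; last first.
  by apply/seteqP; split => n //= rn; apply: nex; exists n; rewrite rn.
apply/esym/eqyP => x x0.
(* Infinitude is shown by exceeding any real [x]: [truncn x + 1] terms equal to 1 suffice. *)
apply: (@le_trans _ _ (\sum_(0 <= k < (Num.truncn x).+1) (\1_(not_yet k) rho)%:E)).
  rewrite (eq_bigr (fun=> 1)) => [|k _]; last first.
    rewrite indicE mem_set// => j _; apply/negP => rj.
    by apply: nex; exists j.
  by rewrite sumEFin sumr_const_nat subn0 lee_fin ltW// truncnS_gt.
exact: nneseries_lim_ge.
Qed.

Local Notation halted := (fun w : config W => w == [::]).

(** Compared term by term: by [esum_alive] the n-th term is a supremum of finite sums of history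
    probabilities, and finitely many such histories, all of length n+1, give disjoint cylinders
    inside [not_yet n]. *)
Lemma expected_time_le_integral (P : probability (runs W) R) :
  (forall H, P (cylinder H) = (hist_prob hist_kernel (rev H))%:E) ->
  expected_time (joint U) next_best halted [:: c] <=
  \int[P]_rho termination_time R rho.
Proof.
move=> PE; under eq_integral do rewrite termination_timeE.
rewrite integral_nneseries//; last first.
  move=> n; apply/measurable_EFinP; apply: measurable_indic.
  exact: not_yet_measurable.
apply: lee_nneseries => [n _ _|n _].
  by apply: iter_expect_next_ge0 => [mu|w]; rewrite ?lee_fin ?joint_ge0.
rewrite integral_indic//; last exact: not_yet_measurable.
rewrite setIT -esum_alive// /running ?eqxx//.
apply: ge_ereal_sup => _ [D [finD Dn] <-].
have cylD r : D r -> measurable (cylinder (rev r) : set (runs W)).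
  by move=> _; exact: cylinder_measurable.
apply: (@le_trans _ _ (P (\bigcup_(r in D) (cylinder (rev r) : set (runs W))))).
  rewrite measure_fin_bigcup//.
    apply: lee_fsum => // r Dr.
    rewrite [leRHS](PE (rev r)) revK -[leRHS]mule1 lee_wpmul2l//.
      by rewrite lee_fin; exact: hist_prob_ge0 hist_kernel_ge0 _.
    by rewrite lee_fin; case: eqP.
  move=> r r' /Dn[sr _] /Dn[sr' _] [rho [/= h h']].
  by apply: (can_inj revK); rewrite -h -h' !size_rev sr sr'.
apply: le_measure; rewrite ?inE.
- by apply: fin_bigcup_measurable.
- exact: not_yet_measurable.
- by rewrite not_yetE; exact: bigcup_subset.
Qed.

End memoryless_scheduler.

(** * Drift of the total measure of the stack *)

Section stack_measure.
Context (R : realType) (W : program) (U : sampling R W).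
Context (h : selem W -> \bar R) (eps delta zeta : R).
Hypotheses (eps_gt0 : (0 < eps)%R) (delta_gt0 : (0 < delta)%R)
  (zeta_gt0 : (0 < zeta)%R).
Hypothesis h_ge0 : forall d, 0 <= h d.
Hypothesis h_lout : forall (f : funs W) nu, h (se (lout f) nu) = 0.

Definition greedy (w : config W) : action :=
  if w is d :: _ then
    let: existT f (l, nu) := val d in
    if instr l is Nondet l1 l2 then
      if h (se l2 nu) <= h (se l1 nu) then th else el
    else tau
  else tau.

Lemma greedy_enabled (s : state W) : enabled s (greedy s.1).
Proof.
case: s => -[//|[[f [l nu]] ld] w] mu; rewrite /enabled /nondet_top /=.
by case: (instr l) => //= l1 l2; case: ifP.
Qed.

Definition stack_measure (w : config W) : \bar R := \sum_(d <- w) h (val d).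
Local Notation H := stack_measure.

Lemma stack_measure_ge0 w : 0 <= H w.
Proof. by apply: sume_ge0. Qed.

Lemma stack_measure_cons d w : H (d :: w) = h (val d) + H w.
Proof. by rewrite /stack_measure big_cons. Qed.

(** A terminal element is dropped from the word, consistently with [h] being 0 on it. *)
Lemma stack_measure_word d w : H (word d ++ w) = h d + H w.
Proof.
rewrite /stack_measure big_cat /= /word; case: insubP => [d' _ <-|].
  by rewrite big_seq1.
rewrite negbK /terminal; case: d => f [l nu] /= /eqP ->.
by rewrite big_nil -/(se (lout f) nu) h_lout.
Qed.

Local Notation K := (expect_next (joint U) (next_best greedy)).

(** At an assignment [zeta] bounds the mean increment; at other labels [H] drops by an amount
    between [eps] and [delta]. The sum covers both cases. *)
Let bound : R := (delta + zeta)%R.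

Let drift w :=
  [/\ eps%:E + K H w <= H w,
      H w < +oo -> H w <= delta%:E + K H w &
      H w < +oo -> K (fun w' => `|H w' - H w|) w <= bound%:E].

(** Serves calls, branchings and nondeterministic labels, where the next stack does not depend on
    the sample. *)
Let drift_det w w' : (forall mu, next_best greedy w mu = w') ->
  eps%:E + H w' <= H w -> (H w < +oo -> H w <= delta%:E + H w') -> drift w.
Proof.
move=> nw lo hi; have KH : K H w = H w'.
  apply: (expect_next_cst (joint_ge0 U) (esum_joint U)) => [|mu].
    exact: stack_measure_ge0.
  by rewrite nw.
split; rewrite ?KH// => Hw.
have Hw' : H w' < +oo.
  by apply: le_lt_trans Hw; apply: le_trans lo; rewrite leeDr// lee_fin ltW.
rewrite (@expect_next_cst _ _ _ _ _ _ _ `|H w' - H w|); last 4 first.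
- exact: joint_ge0.
- exact: esum_joint.
- exact: abse_ge0.
- by move=> mu; rewrite nw.
have := hi Hw; move: lo.
rewrite -(@fineK _ (H w)) ?ge0_fin_numE ?stack_measure_ge0//.
rewrite -(@fineK _ (H w')) ?ge0_fin_numE ?stack_measure_ge0//.
rewrite -EFinB abse_EFin -!EFinD !lee_fin ler_norml /bound => lo' hi'.
move: eps_gt0 delta_gt0 zeta_gt0 lo' hi'.
move: (fine _) (fine _) => a b e0 d0 z0 lo' hi'.
by apply/andP; split; lra.
Qed.

Let esum_Valr (g : valuation (svar W) -> \bar R) :
  \esum_(mu in Valr U) ((joint U mu)%:E * g mu) =
  \esum_(mu in setT) ((joint U mu)%:E * g mu).
Proof.
rewrite esum_mkcond; apply: eq_esum => mu _; case: ifPn => //.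
rewrite notin_setE /Valr /= => /negP; rewrite -leNgt => j0.
suff -> : joint U mu = 0%R by rewrite mul0e.
by apply/eqP; rewrite eq_le j0 joint_ge0.
Qed.

Hypothesis h_assign : forall (f : funs W) (l : label f) nu u l', l != lout f ->
  instr l = Assign u l' ->
  eps%:E + \esum_(mu in Valr U) ((joint U mu)%:E * h (se l' (u nu mu)))
    <= h (se l nu).
Hypothesis h_call : forall (f : funs W) (l : label f) nu g v l', l != lout f ->
  instr l = Call g v l' ->
  eps%:E + h (se (linit g) (v nu)) + h (se l' nu) <= h (se l nu).
Hypothesis h_branch : forall (f : funs W) (l : label f) nu phi l1 l2,
  l != lout f -> instr l = Branch phi l1 l2 ->
  (sat nu phi)%:R%:E * h (se l1 nu) +
  (sat nu (PNot phi))%:R%:E * h (se l2 nu) + eps%:E <= h (se l nu).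
Hypothesis h_nondet : forall (f : funs W) (l : label f) nu l1 l2,
  l != lout f -> instr l = Nondet l1 l2 ->
  maxe (h (se l1 nu)) (h (se l2 nu)) + eps%:E <= h (se l nu).
Hypothesis h_bounded : cond_difference_bounded U h delta zeta.

(** A step rewrites only the top element, so the contribution of the rest of the stack cancels and
    each bound reduces to the condition on [h] at the top label. *)
Lemma stack_measure_drift w : w != [::] -> drift w.
Proof.
case: w => [//|[[f [l nu]] ld] w] _.
have nl : l != lout f by [].
set d : selem W := se l nu.
have HE : H (exist _ d ld :: w) = h d + H w by rewrite stack_measure_cons.
have fin : h d + H w < +oo -> h d < +oo /\ H w < +oo.
  move=> hw; split; apply: le_lt_trans hw.
    by rewrite leeDl// stack_measure_ge0.
  by rewrite leeDr.
have [b_assign b_call b_branch b_nondet] := h_bounded.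
case il : (instr l) => [u l'|g v l'|phi l1 l2|l1 l2].
- have nxt mu : next_best greedy (exist _ d ld :: w) mu =
      word (se l' (u nu mu)) ++ w by rewrite /next_best /= il.
  have KH : K H (exist _ d ld :: w) =
      \esum_(mu in Valr U) ((joint U mu)%:E * h (se l' (u nu mu))) + H w.
    transitivity (\esum_(mu in setT) ((joint U mu)%:E * h (se l' (u nu mu)) +
        (joint U mu)%:E * H w)).
      apply: eq_esum => mu _; rewrite nxt stack_measure_word ge0_muleDr//.
      exact: stack_measure_ge0.
    rewrite esumD; last 2 first.
    + by move=> mu _; rewrite mule_ge0 ?lee_fin ?joint_ge0.
    + by move=> mu _; rewrite mule_ge0 ?stack_measure_ge0 ?lee_fin ?joint_ge0.
    rewrite esum_Valr; congr (_ + _).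
    exact: (expect_next_cst (next := fun w' _ => w') (joint_ge0 U) (esum_joint U)
      (stack_measure_ge0 w) (fun=> erefl)).
  split; rewrite ?KH ?HE.
  + by rewrite addeA leeD2r// (h_assign nu nl il).
  + move=> hw; rewrite addeA leeD2r//.
    by have [] := b_assign f l nu u l' (fin hw).1 nl il.
  + move=> hw; have [hd Hw] := fin hw.
    have [_] := b_assign f l nu u l' hd nl il; rewrite esum_Valr => hz.
    apply: le_trans (_ : zeta%:E <= _); last by rewrite lee_fin /bound lerDr ltW.
    apply: le_trans hz; apply: le_esum => mu _.
    rewrite lee_wpmul2l ?lee_fin ?joint_ge0// nxt stack_measure_word.
    have hwf : H w \is a fin_num by rewrite ge0_fin_numE ?stack_measure_ge0.
    have hdf : h d \is a fin_num by rewrite ge0_fin_numE.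
    (* Cancelling the rest of the stack in the increment is legitimate because [H w] is finite. *)
    by rewrite fin_num_oppeD// addeACA subee// adde0.
- apply: (@drift_det _ (se_init (v nu) :: word (se l' nu) ++ w)).
  + by move=> mu; rewrite /next_best /= il.
  + rewrite HE stack_measure_cons.
    rewrite stack_measure_word !addeA leeD2r//.
    exact: (h_call nu nl il).
  + rewrite HE => hw; rewrite stack_measure_cons.
    rewrite stack_measure_word !addeA leeD2r//.
    exact: (b_call f l nu g v l' (fin hw).1 nl il).
- apply: (@drift_det _ (word (se (if sat nu phi then l1 else l2) nu) ++ w)).
  + by move=> mu; rewrite /next_best /= il.
  + rewrite HE stack_measure_word addeA leeD2r//.
    have := h_branch nu nl il; rewrite /=; case: sat => /=;
      by rewrite mul0e mul1e ?adde0 ?add0e addeC.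
  + rewrite HE => hw; rewrite stack_measure_word addeA leeD2r//.
    have := b_branch f l nu phi l1 l2 (fin hw).1 nl il; rewrite /=; case: sat => /=;
      by rewrite mul0e mul1e ?adde0 ?add0e addeC.
(* The greedy branch attains the maximum, so the lower and the upper bound on the decrease both
   apply to it. *)
- have maxE : h (se (if greedy (exist _ d ld :: w) is th then l1 else l2) nu) =
      maxe (h (se l1 nu)) (h (se l2 nu)).
    rewrite /= il; case: ifPn => [/max_idPl ->//|].
    by rewrite -ltNge => /ltW/max_idPr ->.
  apply: (@drift_det _ (word (se
    (if greedy (exist _ d ld :: w) is th then l1 else l2) nu) ++ w)).
  + by move=> mu; rewrite /next_best /= il.
  + rewrite HE stack_measure_word maxE addeA leeD2r// addeC.
    exact: (h_nondet nu nl il).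
  + rewrite HE => hw; rewrite stack_measure_word maxE addeA leeD2r// addeC.
    exact: (b_nondet f l nu l1 l2 (fin hw).1 nl il).
Qed.

Lemma stack_measure_le_time w : H w < +oo ->
  H w <= delta%:E * expected_time (joint U) (next_best greedy)
    (fun w => w == [::]) w.
Proof.
apply: (@le_expected_time _ _ _ _ _ (joint_ge0 U) (esum_joint U) _ H eps delta bound).
- exact: eps_gt0.
- exact: ltW.
- by rewrite /bound addr_ge0 ?ltW.
- exact: stack_measure_ge0.
- by move=> w' /eqP ->; rewrite /stack_measure big_nil.
- by move=> w' mu /eqP ->.
- by move=> w' /stack_measure_drift[].
- by move=> w' /stack_measure_drift[].
- by move=> w' /stack_measure_drift[].
Qed.

End stack_measure.

(** * From the drift bound to the supremum over schedulers *)

Theorem theorem2 (R : realType) (W : program) (U : sampling R W)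
  (h : selem W -> \bar R) (delta zeta : R)
  (hdelta : (0 < delta)%R) (hzeta : (0 < zeta)%R)
  (hrank : ranking_measure U h)
  (hbnd : cond_difference_bounded U h delta zeta)
  (c : selem W) (hc : (h c < +oo)%E) :
  (h c / delta%:E <= Tbar U c)%E.
Proof.
have [h0 [eps eps0 [h_lout h_assign h_call h_branch h_nondet]]] := hrank.
rewrite inver gt_eqF// /Tbar; case: insubP => [c' _ c'E|]; last first.
  rewrite negbK /terminal; case: c hc => f [l nu] _ /= /eqP ->.
  by rewrite -/(se (lout f) nu) h_lout mul0e.
have [P PE] := run_measure (hist_kernel_ge0 U c' (greedy h))
  (hist_kernel_sum1 U c' (@greedy_enabled _ _ h)).
apply: (@le_trans _ _ (\int[P]_rho termination_time R rho)); last first.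
  (* The greedy scheduler with its law on runs is one candidate in the supremum. *)
  apply: ereal_sup_ubound; exists (memoryless U (@greedy_enabled _ _ h)), P.
  split => // H H0.
  by rewrite [LHS](PE H) (hist_prob_cylinder U c' (@greedy_enabled _ _ h)).
apply: le_trans (expected_time_le_integral (@greedy_enabled _ _ h) PE).
rewrite lee_pdivrMr// muleC.
have hE : stack_measure h [:: c'] = h c by rewrite /stack_measure big_seq1 c'E.
rewrite -hE; apply: (stack_measure_le_time eps0 hdelta hzeta) => //.
by rewrite hE.
Qed.
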